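(* Fix integers $K\ge 3$, $n\ge 1$ and $d\ge 1$. Suppose that $f:\Omega_K^n\to\mathbf{C}$ is of degree at most $d$ and $\|f\|_{\Omega_K^n}\le 1$. Fix $\epsilon,\delta\in(0,1)$ and an integer $$M\ge\frac{e^5d(d+1)\left(\mathrm{BH}^{\le d}_{\Omega_K}\right)^{2d}}{\epsilon^{d+1}}\log\left(\frac{2Kn}{\delta}\right).$$ Then for any $M$ i.i.d. random variables $X_1,\dots,X_M$ uniformly distributed on $\Omega_K^n$, together with the queries $$(X_j,f(X_j)),\qquad 1\le j\le M,$$ one can construct from these data a random polynomial $\widetilde f:\Omega_K^n\to\mathbf{C}$ such that $$\|f-\widetilde f\|_2^2\le\epsilon$$ with probability at least $1-\delta$.
   Context: $\Omega_K=\{1,\omega,\dots,\omega^{K-1}\}$ with $\omega=e^{2\pi i/K}$. Every $f:\Omega_K^n\to\mathbf{C}$ has a unique expansion $f(z)=\sum_{\alpha\in\{0,1,\dots,K-1\}^n}a_\alpha z^\alpha$, $z^\alpha=z_1^{\alpha_1}\cdots z_n^{\alpha_n}$; put $|\alpha|=\alpha_1+\dots+\alpha_n$ (sum of integers, not mod $K$). $f$ is of degree at most $d$ if $a_\alpha=0$ whenever $|\alpha|>d$. $\|f\|_{\Omega_K^n}=\sup_{z\in\Omega_K^n}|f(z)|$, and $\|\cdot\|_2$ is the $L^2$-norm with respect to the uniform probability measure on $\Omega_K^n$. $\mathrm{BH}^{\le d}_{\Omega_K}$ denotes the best (smallest) constant $C$ such that for all $n\ge1$ and all $f=\sum_{|\alpha|\le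 d}a_\alpha z^\alpha$ on $\Omega_K^n$ of degree at most $d$ one has $\big(\sum_\alpha|a_\alpha|^{2d/(d+1)}\big)^{(d+1)/(2d)}\le C\|f\|_{\Omega_K^n}$. ''Constructed from the data'' means that $\widetilde f$ is a function of the samples $(X_j,f(X_j))_{1\le j\le M}$ and the parameters $K,n,d,\epsilon,\delta,M$ only; the rule producing $\widetilde f$ does not otherwise depend on the unknown $f$. The probability is over $X_1,\dots,X_M$. *)

(* Defs.v *)
From HB Require Import structures.
From mathcomp Require Import all_boot all_order all_algebra.
From mathcomp Require Import all_classical all_reals all_analysis.
From mathcomp Require Import complex.

Set Implicit Arguments.
Unset Strict Implicit.
Unset Printing Implicit Defensive.

Import Order.TTheory GRing.Theory Num.Theory ComplexField.Normc.

Local Open Scope classical_set_scope.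
Local Open Scope ring_scope.
Local Open Scope complex_scope.

Section Polynomials.
Variable R : realType.

Definition omega (K : nat) : R[i] :=
  cos (2 * pi / K%:R) +i* sin (2 * pi / K%:R).

(* The finite type whose elements are literally the complex numbers
   1, omega, ..., omega^(K-1). *)
Definition Omega (K : nat) : finType :=
  seq_sub [seq omega K ^+ k | k <- iota 0 K].

Definition cube (K n : nat) : finType := {ffun 'I_n -> Omega K}.

Definition mindex (K n : nat) : finType := {ffun 'I_n -> 'I_K}.

Definition mdeg (K n : nat) (al : mindex K n) : nat := (\sum_(i < n) al i)%N.

Definition monomial (K n : nat) (al : mindex K n) (z : cube K n) : R[i] :=
  \prod_(i < n) ssval (z i) ^+ al i.

Definition zpoly (K n : nat) (a : mindex K n -> R[i]) (z : cube K n) : R[i] :=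
  \sum_(al : mindex K n) a al * monomial al z.

Definition coef_degree_le (K n d : nat) (a : mindex K n -> R[i]) : Prop :=
  forall al : mindex K n, (d < mdeg al)%N -> a al = 0.

(* Since the expansion of f is unique, it does not matter whether it is
   quantified existentially or universally here. *)
Definition degree_le (K n d : nat) (f : cube K n -> R[i]) : Prop :=
  exists2 a : mindex K n -> R[i], f = zpoly a & coef_degree_le d a.

Definition supnorm (K n : nat) (f : cube K n -> R[i]) : R :=
  sup (range (fun z => normc (f z))).

Definition l2norm (K n : nat) (f : cube K n -> R[i]) : R :=
  Num.sqrt ((\sum_(z : cube K n) normc (f z) ^+ 2) / #|cube K n|%:R).

Definition BH_bound (K d : nat) (C : R) : Prop :=
  forall (n : nat) (a : mindex K n -> R[i]), (0 < n)%N -> coef_degree_le d a ->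
    (\sum_(al : mindex K n) normc (a al) `^ (2 * d%:R / (d%:R + 1)))
      `^ ((d%:R + 1) / (2 * d%:R)) <= C * supnorm (zpoly a).

(* Extended-real valued, so that it would be +oo (and not a junk real) if no
   finite constant were admissible. *)
Definition BH (K d : nat) : \bar R :=
  ereal_inf [set C%:E | C in [set C : R | BH_bound K d C]].

End Polynomials.

Section RandomVariables.
Context {R : realType} {disp : measure_display} {T : measurableType disp}.
Variables (P : probability T R) (S : finType).

(* Random variables with values in a finite type S carrying its discrete
   sigma-algebra. *)
Definition discrete_rv (X : T -> S) : Prop :=
  forall A : set S, measurable (X @^-1` A).

Definition uniform_rv (X : T -> S) : Prop :=
  forall s : S, P (X @^-1` [set s]) = (#|S|%:R^-1)%:E.

Definition mutually_independent (M : nat) (X : 'I_M -> T -> S) : Prop :=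
  forall (J : {set 'I_M}) (A : 'I_M -> set S),
    P (\bigcap_(j in [set` J]) (X j @^-1` A j)) =
    (\prod_(j in J) P (X j @^-1` A j))%E.

Definition iid_uniform (M : nat) (X : 'I_M -> T -> S) : Prop :=
  [/\ forall j, discrete_rv (X j),
      forall j, uniform_rv (X j) &
      mutually_independent X].

End RandomVariables.

(* Main.v *)
(** The learner estimates every coefficient [a_al] with [|al| <= d] by the
    empirical mean of [f(X_j) * conj(X_j^al)] and keeps the estimate only if its
    modulus is at least [b (1 + sqrt (d+1))], where
    [b^2 = eps^(d+1) / (6 e (d+1) BH^(2d))].  When all estimates are within [b],
    a kept coefficient has modulus at least [b sqrt (d+1)] and a discarded one
    less than [b (2 + sqrt (d+1))], so that by Parseval the error is bounded by
    the [l^(2d/(d+1))] mass of the coefficients, which Bohnenblust-Hille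
    controls by [BH^(2d/(d+1))].  Closeness of all estimates follows from a
    Chernoff bound for the real and imaginary parts and a union bound over the
    at most [(n+1)^d] multi-indices.  As the samples are uniform on a finite
    set, every probability is a count of [M]-tuples of points of the cube. *)

Require Import Defs.
From mathcomp Require Import all_boot all_order all_algebra.
From mathcomp Require Import all_classical all_reals all_analysis.
From mathcomp Require Import complex ring lra.

Set Implicit Arguments.
Unset Strict Implicit.
Unset Printing Implicit Defensive.

Import Order.TTheory GRing.Theory Num.Theory ComplexField.Normc.

Local Open Scope classical_set_scope.
Local Open Scope ring_scope.
Local Open Scope complex_scope.

(** * Modulus, real part and imaginary part of complex numbers *)

Lemma normc_ge0 (R : realType) (x : R[i]) : 0 <= normc x.
Proof. exact: (normr_ge0 (x : Rcomplex R)). Qed.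

Lemma sqr_normcE (R : realType) (x : R[i]) :
  normc x ^+ 2 = complex.Re x ^+ 2 + complex.Im x ^+ 2.
Proof. by case: x => a b /=; rewrite sqr_sqrtr // addr_ge0 ?sqr_ge0. Qed.

Lemma mulC_conjc (R : realType) (x : R[i]) : x * x^* = (normc x ^+ 2)%:C.
Proof. by case: x => a b; rewrite sqr_normcE; simpc; congr (_ +i* _); ring. Qed.

Lemma Re_sum (R : realType) (I : finType) (F : I -> R[i]) :
  complex.Re (\sum_i F i) = \sum_i complex.Re (F i).
Proof. exact: (raddf_sum (@complex.Re R : {additive Rcomplex R -> R})). Qed.

Lemma Im_sum (R : realType) (I : finType) (F : I -> R[i]) :
  complex.Im (\sum_i F i) = \sum_i complex.Im (F i).
Proof. exact: (raddf_sum (@complex.Im R : {additive Rcomplex R -> R})). Qed.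

(** * Exponential estimates and a Chernoff bound in counting form *)

(* Squaring twice the reciprocal of [1 - x/4 <= expR (- x/4)]. *)
Lemma expR_le_quad (R : realType) (x : R) :
  `|x| <= 4^-1 -> expR x <= 1 + x + 3 / 4 * x ^+ 2.
Proof.
move=> hx; have /andP[hx1 hx2] : - 4^-1 <= x <= 4^-1 by rewrite -ler_norml.
pose y := x / 4; have xy : x = 4 * y by rewrite /y; lra.
have hy1 : - 16^-1 <= y by rewrite /y; lra.
have hy2 : y <= 16^-1 by rewrite /y; lra.
have h1 : 0 < 1 - y by lra.
have h2 : (1 - y) ^+ 4 <= expR (- x).
  have -> : - x = - y * 4%:R by lra.
  rewrite expRM_natr lerXn2r // ?nnegrE ?expR_ge0 //; first exact: ltW.
  exact: expR_ge1Dx.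
suff h3 : 1 <= (1 + x + 3 / 4 * x ^+ 2) * (1 - y) ^+ 4.
  rewrite -(ler_pM2r (exprn_gt0 4 h1)); apply: le_trans h3.
  apply: (@le_trans _ _ (expR x * expR (- x))); last by rewrite expRxMexpNx_1.
  by rewrite ler_wpM2l ?expR_ge0.
(* The terms linear in y cancel; in the bracket, 28 y <= 28/16 < 2 keeps the remainder
   nonnegative. *)
have -> : (1 + x + 3 / 4 * x ^+ 2) * (1 - y) ^+ 4 =
   1 + y ^+ 2 * (2 - 28 * y + y ^+ 2 * (57 - 44 * y + 12 * y ^+ 2)).
  by rewrite xy; field.
have q : 0 <= y ^+ 2 by rewrite sqr_ge0.
have p : 0 <= y ^+ 2 * (57 - 44 * y + 12 * y ^+ 2) by rewrite mulr_ge0 //; lra.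
by rewrite lerDl mulr_ge0 //; lra.
Qed.

(** The value 45 is 36 * 5/4: it turns the factor e^4 / 36 left over from the sample size into the
    5/4 of [union_bound_small]. The proof goes through e >= (17/16)^16 >= 2.6. *)
Lemma expR4_ge45 (R : realType) : 45 <= expR 4 :> R.
Proof.
have h : 1 + 16^-1 <= expR (16^-1) :> R := expR_ge1Dx _.
have h2 : (17 / 16) ^+ 16 <= expR 1 :> R.
  have -> : 1 = 16^-1 * 16%:R :> R by lra.
  rewrite expRM_natr lerXn2r ?nnegrE ?expR_ge0 //; lra.
have h3 : 26 / 10 <= expR 1 :> R.
  by apply: le_trans h2; lra.
have -> : 4 = 1 * 4%:R :> R by lra.
rewrite expRM_natr; apply: (@le_trans _ _ ((26 / 10) ^+ 4)); first lra.
rewrite lerXn2r // nnegrE ?expR_ge0 //; lra.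
Qed.

(* The bound [3 / 16] keeps [2 / 3 * t * g s] in the range of [expR_le_quad]. *)
Lemma chernoff (R : realType) (S : finType) (g : S -> R) (M : nat) (t : R) :
  \sum_s g s = 0 -> (forall s, `|g s| <= 2) ->
  \sum_s g s ^+ 2 <= #|S|%:R -> 0 <= t <= 3 / 16 ->
  \sum_(x : {ffun 'I_M -> S} | M%:R * t < \sum_j g (x j)) 1
    <= #|S|%:R ^+ M * expR (- (M%:R * t ^+ 2 / 3)) :> R.
Proof.
(* This [l] minimises 3/4 l^2 - l t, with minimum - t^2 / 3. *)
move=> g0 g2 gv /andP[t0 t8]; pose l := 2 / 3 * t.
have l0 : 0 <= l by rewrite /l; lra.
have mgf : \sum_s expR (l * g s) <= #|S|%:R * expR (3 / 4 * l ^+ 2).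
  apply: (@le_trans _ _ (\sum_s (1 + l * g s + 3 / 4 * (l * g s) ^+ 2))).
    apply: ler_sum => s _; apply: expR_le_quad; rewrite normrM (ger0_norm l0).
    have := g2 s; have := normr_ge0 (g s); rewrite /l; nra.
  rewrite 2!big_split /= sumr_const -mulr_sumr g0 mulr0 addr0.
  under eq_bigr do rewrite exprMn mulrA.
  rewrite -mulr_sumr.
  apply: (@le_trans _ _ (#|S|%:R * (1 + 3 / 4 * l ^+ 2))).
    rewrite mulrDr mulr1 lerD2l mulrC ler_wpM2r //.
    by rewrite mulr_ge0 ?sqr_ge0//; lra.
  by rewrite ler_wpM2l // expR_ge1Dx.
(* Markov's inequality: the indicator of the tail is at most the exponential of l times the excess.
   The sum over tuples then factors into M equal sums over S. *)
apply: (@le_trans _ _ (\sum_(x : {ffun 'I_M -> S})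
    expR (- (l * (M%:R * t))) * \prod_j expR (l * g (x j)))).
  rewrite big_mkcond; apply: ler_sum => x _; case: ifP => hx; last first.
    by rewrite mulr_ge0 ?expR_ge0 // prodr_ge0 // => i _; exact: expR_ge0.
  rewrite -expR_sum -mulr_sumr -expRD; apply: (le_trans _ (expR_ge1Dx _)).
  rewrite lerDl addrC subr_ge0; by rewrite ler_wpM2l // ltW.
rewrite -mulr_sumr -(bigA_distr_bigA (fun (_ : 'I_M) s => expR (l * g s))).
rewrite prodr_const card_ord.
apply: (@le_trans _ _ (expR (- (l * (M%:R * t))) *
    (#|S|%:R * expR (3 / 4 * l ^+ 2)) ^+ M)).
  rewrite ler_wpM2l ?expR_ge0 // lerXn2r ?nnegrE //.
  by apply: sumr_ge0 => s _; exact: expR_ge0.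
rewrite exprMn mulrCA ler_wpM2l ?exprn_ge0 //.
rewrite -expRM_natr -expRD ler_expR /l; lra.
Qed.

(** * Counting multi-indices of bounded degree *)

(** By induction on d: a multi-index of degree at most d+1 comes from one of degree at most d by
    raising one of n coordinates or none, which gives n+1 choices at each step. *)
Lemma card_mdeg_le (n K d : nat) : (0 < K)%N ->
  (#|[set al : mindex K n | (mdeg al <= d)%N]%SET| <= n.+1 ^ d)%N.
Proof.
case: K => // K _; elim: d => [|d IHd].
  rewrite expn0 -(cards1 ([ffun=> ord0] : mindex K.+1 n)) subset_leq_card //.
  apply/fintype.subsetP => al; rewrite !inE leqn0 sum_nat_eq0.
  move=> /fintype.forallP al0.
  by apply/eqP/ffunP => i; rewrite ffunE; apply/val_inj/eqP; exact: al0.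
pose raise (o : option 'I_n) (al : mindex K.+1 n) : mindex K.+1 n :=
  [ffun j => if o == Some j then inord (al j).+1 else al j].
have sub : [set al : mindex K.+1 n | (mdeg al <= d.+1)%N]%SET \subset
    [set raise o al | o in [set: option 'I_n],
                      al in [set al : mindex K.+1 n | (mdeg al <= d)%N]]%SET.
  apply/fintype.subsetP => al; rewrite inE => hal; apply/imset2P.
  have [all0|] := leqP (mdeg al) d.
    exists None al; rewrite ?inE //.
    by apply/ffunP => j; rewrite ffunE.
  move=> hd; have [i ali] : exists i, (0 < al i)%N.
    apply: contrapT => al0; move: hd; rewrite /mdeg big1 // => i _.
    apply/eqP; rewrite -leqn0 leqNgt; apply/negP => ali; apply: al0.
    by exists i.
  pose be : mindex K.+1 n :=
    [ffun j => if j == i then inord (al j).-1 else al j].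
  have bei : (be i).+1 = al i.
    by rewrite ffunE eqxx inordK ?prednK // ltnW.
  exists (Some i) be; rewrite ?inE //.
    rewrite -ltnS (leq_trans _ hal) // /mdeg (bigD1 i) //=.
    rewrite [X in (_ < X)%N](bigD1 i) //= -bei.
    rewrite -addSn leq_add2l leq_sum // => j /negbTE ji.
    by rewrite ffunE ji.
  apply/ffunP => j; rewrite ffunE; case: eqP => [[<-]|ij].
    by rewrite bei inord_val.
  by rewrite ffunE; case: eqP => // ji; case: ij; rewrite ji.
apply: leq_trans (subset_leq_card sub) _.
rewrite curry_imset2X (leq_trans (leq_imset_card _ _)) // cardsX cardsT.
by rewrite card_option card_ord expnS leq_mul2l IHd orbT.
Qed.

(** * Roots of unity, orthogonality of monomials, Parseval *)

Lemma omegaX (R : realType) (K k : nat) :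
  omega R K ^+ k =
    cos (k%:R * (2 * pi / K%:R)) +i* sin (k%:R * (2 * pi / K%:R)).
Proof.
elim: k => [|k IHk]; first by rewrite expr0 mul0r cos0 sin0.
rewrite exprS IHk /omega; set t := 2 * pi / K%:R.
rewrite (_ : k.+1%:R * t = k%:R * t + t); last by rewrite -natr1 mulrDl mul1r.
rewrite cosD sinD; simpc.
by congr (_ +i* _); ring.
Qed.

Lemma normc_omega (R : realType) (K : nat) : normc (omega R K) = 1.
Proof. by rewrite /= cos2Dsin2 sqrtr1. Qed.

Lemma prim_root_omega (R : realType) (K : nat) : (0 < K)%N ->
  K.-primitive_root (omega R K).
Proof.
move=> K0; have Kn0 : K%:R != 0 :> R by rewrite pnatr_eq0 -lt0n.
rewrite /primitive_root_of_unity K0; apply/fintype.forallP => i; apply/eqP.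
rewrite unity_rootE omegaX; apply/eqP/eqP => [[h _]|->]; last first.
  by rewrite mulrCA divff // mulr1 mulr_natl cos2pi sin2pi.
apply/eqP; rewrite eqn_leq ltn_ord /= leqNgt; apply/negP => iK.
have K0r : 0 < K%:R :> R by rewrite ltr0n.
(* Half the angle of omega^(i+1). For i+1 < K it lies strictly between 0 and pi, so cos(2x) = 1 - 2
   sin(x)^2 < 1. *)
pose x := i.+1%:R * pi / K%:R : R.
have : 0 < sin x.
  apply: sin_gt0_pi; rewrite /x divr_gt0 ?mulr_gt0 ?pi_gt0 ?ltr0n //=.
  by rewrite ltr_pdivrMr // mulrC ltr_pM2l ?pi_gt0 // ltr_nat.
have e : i.+1%:R * (2 * pi / K%:R) = x + x by rewrite /x; field.
move: h; rewrite e cosD; have := cos2Dsin2 x; nra.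
Qed.

Lemma uniq_omega_powers (R : realType) (K : nat) : (0 < K)%N ->
  uniq [seq omega R K ^+ k | k <- iota 0 K].
Proof.
move=> K0; rewrite map_inj_in_uniq ?iota_uniq // => i j.
rewrite !mem_iota /= => iK jK /eqP.
by rewrite (eq_prim_root_expr (prim_root_omega R K0)) !modn_small // => /eqP.
Qed.

Lemma card_Omega (R : realType) (K : nat) : (0 < K)%N -> #|Omega R K| = K.
Proof.
by move=> K0; rewrite card_seq_sub ?uniq_omega_powers // size_map size_iota.
Qed.

Lemma card_cube (R : realType) (K n : nat) : (0 < K)%N ->
  #|cube R K n| = (K ^ n)%N.
Proof. by move=> K0; rewrite card_ffun card_Omega // card_ord. Qed.

Lemma sum_Omega (R : realType) (K : nat) (F : R[i] -> R[i]) : (0 < K)%N ->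
  \sum_(z : Omega R K) F (ssval z) = \sum_(k < K) F (omega R K ^+ k).
Proof.
move=> K0.
have mem (k : 'I_K) :
    omega R K ^+ k \in [seq omega R K ^+ k | k <- iota 0 K].
  by apply: map_f; rewrite mem_iota ltn_ord.
pose h (k : 'I_K) : Omega R K := SeqSub (mem k).
rewrite (reindex h) //=; apply/onW_bij/inj_card_bij; last first.
  by rewrite card_ord card_Omega.
move=> i j /(congr1 (@ssval _ _)) /= /eqP.
rewrite (eq_prim_root_expr (prim_root_omega R K0)) !modn_small // => /eqP.
exact: val_inj.
Qed.

(** This is a geometric sum whose ratio [zeta] is a K-th root of unity. By primitivity of omega the
    ratio is 1 only if a = b, both exponents being below K. *)
Lemma Omega_orthogonality (R : realType) (K : nat) (a b : 'I_K) :
  \sum_(z : Omega R K) ssval z ^+ a * (ssval z ^+ b)^* =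
    if a == b then K%:R else 0.
Proof.
have K0 : (0 < K)%N by case: K a b => [[]|].
rewrite (sum_Omega (fun x => x ^+ a * (x ^+ b)^*)) //.
set w := omega R K; have ww : w * w^* = 1.
  by rewrite mulC_conjc normc_omega expr1n.
pose zeta := w ^+ a * (w ^+ b)^*.
under eq_bigr => k _.
  rewrite -!exprM [(k * a)%N]mulnC [(k * b)%N]mulnC !exprM rmorphXn /=.
  rewrite -exprMn -/zeta.
  over.
have zK : zeta ^+ K = 1.
  rewrite /zeta rmorphXn /= exprMn -!exprM ![(_ * K)%N]mulnC !exprM.
  rewrite -rmorphXn /= (prim_expr_order (prim_root_omega R K0)).
  by rewrite rmorph1 !expr1n mulr1.
case: eqP => [ab|ab].
  have z1 : zeta = 1 by rewrite /zeta ab rmorphXn /= -exprMn ww expr1n.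
  under eq_bigr do rewrite z1 expr1n.
  by rewrite sumr_const card_ord.
have : (zeta - 1) * \sum_(k < K) zeta ^+ k = 0 by rewrite -subrX1 zK subrr.
move/eqP; rewrite mulf_eq0 => /orP[|/eqP//].
rewrite subr_eq0 => /eqP z1; case: ab; apply/val_inj/eqP.
have : w ^+ a == w ^+ b.
  have -> : w ^+ a = zeta * w ^+ b.
    by rewrite /zeta -mulrA [_^* * _]mulrC rmorphXn /= -exprMn ww expr1n mulr1.
  by rewrite z1 mul1r.
by rewrite (eq_prim_root_expr (prim_root_omega R K0)) !modn_small.
Qed.

Lemma monomial_orthogonality (R : realType) (K n : nat) (al be : mindex K n) :
  \sum_(z : cube R K n) monomial al z * (monomial be z)^* =
    if al == be then #|cube R K n|%:R else 0.
Proof.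
under eq_bigr => z _ do rewrite /monomial rmorph_prod -big_split /=.
rewrite -(bigA_distr_bigA
  (fun i (s : Omega R K) => ssval s ^+ al i * (ssval s ^+ be i)^*)).
under eq_bigr do rewrite Omega_orthogonality.
case: eqP => [->|ab].
  under eq_bigr do rewrite eqxx.
  rewrite prodr_const card_ord -natrX; congr (_ %:R).
  (* For n = 0 both sides are 1; otherwise a coordinate of [be] witnesses K > 0, as [card_Omega]
     requires. *)
  rewrite card_ffun card_ord; case: n be {al} => [|n] be //.
  by rewrite card_Omega //; case: K be => // be; case: (be ord0).
have [i abi] : exists i, al i != be i.
  apply: contrapT => h; apply: ab; apply/ffunP => i; apply/eqP.
  by apply: contraT => abi; case: h; exists i.
by rewrite (bigD1 i) //= (negbTE abi) mul0r.
Qed.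

Lemma sum_zpoly_conj_monomial (R : realType) (K n : nat)
    (a : mindex K n -> R[i]) (al : mindex K n) :
  \sum_z zpoly a z * (monomial al z)^* = #|cube R K n|%:R * a al.
Proof.
under eq_bigr => z _ do rewrite /zpoly mulr_suml.
rewrite exchange_big /= (bigD1 al) //= [X in _ + X]big1 => [|be /negbTE ba].
  under eq_bigr do rewrite -mulrA.
  by rewrite -mulr_sumr monomial_orthogonality eqxx addr0 mulrC.
under eq_bigr do rewrite -mulrA.
by rewrite -mulr_sumr monomial_orthogonality ba mulr0.
Qed.

Lemma parseval (R : realType) (K n : nat) (a : mindex K n -> R[i]) :
  (0 < K)%N ->
  l2norm (zpoly a) ^+ 2 = \sum_al normc (a al) ^+ 2.
Proof.
move=> K0; have c0 : #|cube R K n|%:R != 0 :> R.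
  by rewrite pnatr_eq0 card_cube // -lt0n expn_gt0 K0.
rewrite sqr_sqrtr; last first.
  by rewrite divr_ge0 // sumr_ge0 // => z _; rewrite sqr_ge0.
(* The identity is moved to the complex numbers, where |f|^2 = f conj(f); expanding only the
   conjugate leaves the sums of [sum_zpoly_conj_monomial]. *)
apply: (mulIf c0); rewrite mulfVK //; apply: (@complexI R).
rewrite rmorph_sum rmorphM rmorph_sum rmorph_nat /= mulr_suml.
under eq_bigr => z _ do rewrite -mulC_conjc {2}/zpoly rmorph_sum mulr_sumr /=.
rewrite exchange_big /=; apply: eq_bigr => al _.
under eq_bigr do rewrite rmorphM mulrCA.
by rewrite -mulr_sumr sum_zpoly_conj_monomial -mulC_conjc /=; ring.
Qed.

Lemma normc_monomial (R : realType) (K n : nat) (al : mindex K n)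
    (z : cube R K n) :
  normc (monomial al z) = 1.
Proof.
rewrite /monomial; elim/big_ind: _ => [|x y hx hy|i _]; first exact: normc1.
  by rewrite normcM hx hy mulr1.
have normcX (x : R[i]) m : normc x = 1 -> normc (x ^+ m) = 1.
  by move=> x1; elim: m => [|m IH]; rewrite ?normc1 // exprS normcM x1 IH mulr1.
have /mapP[k _ ->] := ssvalP (z i).
by apply: (normcX); apply: normcX; exact: normc_omega.
Qed.

(** * Error of the thresholded coefficients *)

(* Each coefficient is charged to [|a_i|^(2d/(d+1))]: kept ones because
   [|a_i| >= b sqrt(d+1)], discarded ones because [|a_i| < b (2 + sqrt(d+1))]. *)
Lemma thresholding_error (R : realType) (I : finType) (A : pred I)
    (a w : I -> R[i]) (d : nat) (eps B b : R) :
  (0 < d)%N -> 0 < eps -> 1 <= B -> 0 < b ->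
  b ^+ 2 = eps ^+ d.+1 / (6 * expR 1 * d.+1%:R * B ^+ (2 * d)) ->
  (forall i, ~~ A i -> a i = 0) -> (forall i, A i -> normc (w i - a i) <= b) ->
  \sum_i normc (a i) `^ (2 * d%:R / (d%:R + 1)) <=
    B `^ (2 * d%:R / (d%:R + 1)) ->
  \sum_i normc (a i - if A i && (b * (1 + Num.sqrt d.+1%:R) <= normc (w i))
                      then w i else 0) ^+ 2 <= eps.
Proof.
move=> d0 e0 B1 b0 bE aA wA asum.
set D := d.+1%:R : R; set s := Num.sqrt D.
have D2 : 2 <= D by rewrite ler_nat.
have D0 : 0 < D by lra.
have DE : d%:R + 1 = D by rewrite natr1.
have ss : s ^+ 2 = D by rewrite sqr_sqrtr // ltW.
have s1 : 7 / 5 <= s.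
  have : 0 <= s := sqrtr_ge0 _; nra.
have n0 := @normc_ge0 R.
(* The exponents q and r add up to 2, so x^2 = x^q x^r. *)
set q := _ / _ in asum; pose r := 2 / D.
have q0 : 0 < q by rewrite /q DE divr_gt0 // mulr_gt0 // ltr0n.
have r0 : 0 < r by rewrite divr_gt0.
have qr : q + r = 2.
  by rewrite /q /r -DE; field; rewrite DE gt_eqF.
pose u := b * (2 + s); pose v := b * s.
have u0 : 0 < u by rewrite mulr_gt0 //; lra.
have v0 : 0 < v by rewrite mulr_gt0 //; lra.
have sqE (x : R) : 0 <= x -> x ^+ 2 = x `^ q * x `^ r.
  by move=> x0; rewrite -powRD qr ?powR_mulrn // pnatr_eq0.
have le_pow (x y z : R) : 0 <= z -> 0 <= x -> x <= y -> x `^ z <= y `^ z.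
  move=> z0 x0 xy; apply: ge0_ler_powR => //; rewrite nnegrE //.
  exact: le_trans xy.
(* A discarded term has |a_i| <= u and costs at most u^r |a_i|^q. A kept one costs at most b^2 = v^2
   / D, hence at most u^r |a_i|^q / D because v <= u and v <= |a_i|. The constant [c] covers
   both. *)
pose c := u `^ r * (1 + D^-1).
have c0 : 0 <= c by rewrite mulr_ge0 ?powR_ge0 // addr_ge0 // invr_ge0 ltW.
have cu : u `^ r <= c by rewrite ler_peMr ?powR_ge0 // lerDl invr_ge0 ltW.
have term i : normc (a i - if A i && (b * (1 + s) <= normc (w i))
                           then w i else 0) ^+ 2 <= c * normc (a i) `^ q.
  have [Ai|/aA->] := boolP (A i); last first.
    by rewrite andFb subr0 normc0 expr0n mulr_ge0 ?powR_ge0.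
  have wa := wA i Ai; rewrite andTb; case: ifPn => [hw|]; last first.
    rewrite -ltNge subr0 => hw.
    rewrite (sqE _ (n0 _)) mulrC ler_wpM2r ?powR_ge0 //; apply: le_trans cu.
    apply: le_pow => //; first exact: ltW.
    have : normc (a i) <= normc (w i) + normc (w i - a i).
      have -> : normc (w i - a i) = normc (a i - w i) by rewrite -normcN opprB.
      by apply: le_trans (le_normcD _ _); rewrite addrC subrK.
    rewrite /u; nra.
  have va : v <= normc (a i).
    have : normc (w i) <= normc (w i - a i) + normc (a i).
      by apply: le_trans (le_normcD _ _); rewrite subrK.
    rewrite /v; nra.
  have -> : normc (a i - w i) = normc (w i - a i) by rewrite -normcN opprB.
  apply: (@le_trans _ _ (b ^+ 2)); first by rewrite lerXn2r ?nnegrE // ltW.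
  apply: (@le_trans _ _ (D^-1 * u `^ r * v `^ q)).
    have -> : b ^+ 2 = D^-1 * (v `^ r * v `^ q).
      rewrite [v `^ r * _]mulrC -sqE ?ltW // /v exprMn ss mulrC.
      by rewrite mulfK ?gt_eqF.
    rewrite mulrA ler_wpM2r ?powR_ge0 // ler_wpM2l ?invr_ge0 ?(ltW D0) //.
    apply: le_pow; [exact: ltW | exact: ltW | rewrite /u /v; nra].
  apply: ler_pM; rewrite ?mulr_ge0 ?powR_ge0 ?invr_ge0 ?(ltW D0) //.
    by rewrite mulrC ler_wpM2l ?powR_ge0 // lerDr.
  by apply: le_pow => //; exact: ltW.
apply: le_trans (ler_sum _ (fun i _ => term i)) _.
rewrite -mulr_sumr; apply: le_trans (ler_wpM2l c0 asum) _.
have B0 : 0 < B by lra.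
(* The 6 in [bE] is spent here: s >= 7/5 gives (2 + s)^2 <= 6 s^2 = 6 D. *)
have uE : u ^+ 2 <= eps ^+ d.+1 / (expR 1 * B ^+ (2 * d)).
  have -> : eps ^+ d.+1 / (expR 1 * B ^+ (2 * d)) = 6 * D * b ^+ 2.
    rewrite bE -/D; field.
    by rewrite !gt_eqF ?expR_gt0 ?exprn_gt0.
  rewrite /u exprMn mulrC ler_wpM2r ?sqr_ge0 //.
  rewrite -ss; nra.
(* Taking the power 1/D turns eps^D into eps, B^(2d) into B^q, and the factor e into exp(1/D), which
   at the end absorbs 1 + 1/D. *)
have ur : u `^ r <= eps * expR (- D^-1) / B `^ q.
  have -> : u `^ r = (u ^+ 2) `^ D^-1.
    by rewrite -(powR_mulrn 2 (ltW u0)) -powRrM.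
  apply: le_trans (le_pow _ _ _ _ _ uE) _;
    rewrite ?sqr_ge0 ?invr_ge0 ?(ltW D0) //.
  rewrite invfM -expRN mulrA powRM ?powRM ?mulr_ge0 ?exprn_ge0 ?expR_ge0
    ?invr_ge0 ?(ltW e0) ?exprn_ge0 ?(ltW B0) //.
  rewrite -(powR_mulrn _ (ltW e0)) -powRrM divff ?gt_eqF // powRr1 ?(ltW e0) //.
  rewrite -expRM mulN1r.
  rewrite -[(B ^+ _)^-1]powR_inv1 ?exprn_ge0 ?(ltW B0) //.
  rewrite -(powR_mulrn _ (ltW B0)) -!powRrM.
  rewrite (_ : (2 * d)%:R * (-1 * D^-1) = - q) ?powRN //.
  by rewrite /q DE natrM; ring.
apply: (@le_trans _ _ (eps * expR (- D^-1) / B `^ q * (1 + D^-1) * B `^ q)).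
  rewrite ler_wpM2r ?powR_ge0 // ler_wpM2r // addr_ge0 // invr_ge0 ltW //.
rewrite mulrAC mulfVK ?gt_eqF ?powR_gt0 // -mulrA ler_piMr ?(ltW e0) //.
by rewrite expRN mulrC ler_pdivrMr ?expR_gt0 // mul1r expR_ge1Dx.
Qed.

(** * The sup norm and the Bohnenblust-Hille constant *)

Lemma normc_le_supnorm (R : realType) (K n : nat) (f : cube R K n -> R[i]) z :
  normc (f z) <= supnorm f.
Proof.
apply: ub_le_sup; last by exists z.
exists (\sum_z normc (f z)) => _ [y _ <-].
by rewrite (bigD1 y) //= lerDl sumr_ge0 // => i _; exact: normc_ge0.
Qed.

Lemma supnorm_cst1 (R : realType) (K n : nat) : (0 < K)%N ->
  supnorm (fun _ : cube R K n => 1) = 1.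
Proof.
move=> K0; rewrite /supnorm (_ : range _ = [set 1]) ?sup1 //.
have /card_gt0P[z _] : (0 < #|cube R K n|)%N.
  by rewrite card_cube // expn_gt0 K0.
apply/seteqP; split=> [_ [_ _ <-]|_ ->]; first exact: normc1.
by exists z => //; exact: normc1.
Qed.

(* The constant polynomial 1. *)
Lemma BH_bound_ge1 (R : realType) (K d : nat) (C : R) :
  (0 < K)%N -> (0 < d)%N ->
  BH_bound K d C -> 1 <= C.
Proof.
move=> K0 d0 hC; pose z0 : mindex K 1 := [ffun=> Ordinal K0].
pose a (al : mindex K 1) : R[i] := if al == z0 then 1 else 0.
have q0 : 0 < 2 * d%:R / (d%:R + 1) :> R.
  by rewrite divr_gt0 ?mulr_gt0 ?ltr0n // natr1 ltr0n.
have adeg : coef_degree_le d a.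
  move=> al; rewrite /a; case: eqP => // ->; rewrite /mdeg big1 // => i _.
  by rewrite ffunE.
have aE : zpoly a = fun _ : cube R K 1 => 1.
  apply/funext => z; rewrite /zpoly (bigD1 z0) //= big1 => [|al /negbTE al0].
    rewrite /a eqxx mul1r addr0 /monomial big1 // => i _.
    by rewrite ffunE expr0.
  by rewrite /a al0 mul0r.
have := hC 1%N a (ltn0Sn 0) adeg; rewrite aE supnorm_cst1 // mulr1.
rewrite (bigD1 z0) //= big1 => [|al /negbTE al0].
  by rewrite /a eqxx (@normc1 R) powR1 addr0 powR1.
by rewrite /a al0 (@normc0 R) powR0 // gt_eqF.
Qed.

Lemma BH_ge1 (R : realType) (K d : nat) : (0 < K)%N -> (0 < d)%N ->
  (1 <= BH R K d)%E.
Proof.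
move=> K0 d0; apply: le_ereal_inf_tmp => _ [C hC <-].
by rewrite lee_fin (BH_bound_ge1 K0 d0 hC).
Qed.

Lemma sum_coef_le_BH (R : realType) (K n d : nat) (B : R)
    (a : mindex K n -> R[i]) :
  (0 < K)%N -> (0 < n)%N -> (0 < d)%N -> BH R K d = B%:E ->
  coef_degree_le d a ->
  supnorm (zpoly a) <= 1 ->
  \sum_al normc (a al) `^ (2 * d%:R / (d%:R + 1)) <=
    B `^ (2 * d%:R / (d%:R + 1)).
Proof.
move=> K0 n0 d0 BE adeg a1; set q := _ / _; set S := \sum_al _.
have q0 : 0 < q by rewrite divr_gt0 ?mulr_gt0 ?ltr0n // natr1 ltr0n.
have S0 : 0 <= S by apply: sumr_ge0 => al _; exact: powR_ge0.
have qV : (d%:R + 1) / (2 * d%:R) = q^-1 :> R by rewrite invf_div.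
have SB : S `^ q^-1 <= B.
  (* As [BH] is an infimum, it is enough to stay below every admissible C. That C >= 1 makes it
     nonnegative, so that C times a sup norm at most 1 is at most C. *)
  rewrite -lee_fin -BE; apply: le_ereal_inf_tmp => _ [C hC <-].
  have C1 := BH_bound_ge1 K0 d0 hC.
  rewrite lee_fin -qV; apply: le_trans (hC n a n0 adeg) _.
  by rewrite ler_piMr // (le_trans _ C1).
have -> : S = (S `^ q^-1) `^ q by rewrite -powRrM mulVf ?gt_eqF // powRr1.
apply: ge0_ler_powR; rewrite ?nnegrE ?powR_ge0 //; first exact: ltW.
exact: le_trans (powR_ge0 _ _) SB.
Qed.

(** * From probabilities to counts; concentration of empirical means *)

(** The event is the disjoint union of the fibres [F x] of the sample tuple; independence over the
    full index set gives each fibre the mass |S|^(-M). *)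
Lemma prob_iid_uniform (R : realType) (disp : measure_display)
    (T : measurableType disp) (P : probability T R) (S : finType) (M : nat)
    (X : 'I_M -> T -> S) (Q : {pred {ffun 'I_M -> S}}) : iid_uniform P X ->
  P [set w | Q [ffun j => X j w]] = ((\sum_(x | Q x) 1) / #|S|%:R ^+ M)%:E.
Proof.
move=> [mX uX iX].
pose F (x : {ffun 'I_M -> S}) : set T :=
  \bigcap_(j in [set` [set: 'I_M]%SET]) (X j @^-1` [set x j]).
have FP x : P (F x) = ((#|S|%:R ^+ M)^-1)%:E.
  rewrite /F (iX [set: 'I_M]%SET (fun j => [set x j])).
  under eq_bigr do rewrite uX.
  by rewrite prodEFin prodr_const cardsT card_ord exprVn.
have Fm x : measurable (F x).
  by apply: fin_bigcap_measurable => [|j _]; [exact: finite_finset|exact: mX].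
have FE x w : F x w <-> [ffun j => X j w] = x.
  split=> [h|<- j _ /=]; last by rewrite ffunE.
  by apply/ffunP => j; rewrite ffunE; apply: h; rewrite /= inE.
have -> : [set w | Q [ffun j => X j w]] = \bigcup_(x in [set` Q]) F x.
  apply/seteqP; split => [w Qw|w [x Qx /FE xw]].
    by exists [ffun j => X j w]; [exact: Qw|exact/FE].
  by rewrite /= xw.
rewrite measure_fin_bigcup //; last first.
  apply/trivIsetP => x y _ _ xy; apply/seteqP; split=> // w [/FE xw /FE yw].
  by move: xy; rewrite -xw -yw eqxx.
rewrite -(bigfs _ (index_enum_uniq _)) => [|x _]; last first.
  by rewrite mem_index_enum.
rewrite (eq_bigr _ (fun x _ => FP x)).
by rewrite sumEFin mulr_suml; under [in RHS]eq_bigr do rewrite mul1r.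
Qed.

(** Centring at the mean enlarges the pointwise bound from 1 to 2, but the second moment stays at
    most 1, since a variance is at most the raw second moment. *)
Lemma chernoff_mean (R : realType) (S : finType) (g : S -> R) (mu : R)
    (M : nat) (t : R) :
  (0 < #|S|)%N -> (forall s, `|g s| <= 1) -> \sum_s g s = #|S|%:R * mu ->
  0 <= t <= 3 / 16 ->
  \sum_(x : {ffun 'I_M -> S} | M%:R * t < \sum_j (g (x j) - mu)) 1
    <= #|S|%:R ^+ M * expR (- (M%:R * t ^+ 2 / 3)) :> R.
Proof.
move=> S0 g1 gmu ht; have S0r : 0 < #|S|%:R :> R by rewrite ltr0n.
have mu1 : `|mu| <= 1.
  rewrite -(ler_pM2l S0r) -{1}(ger0_norm (ltW S0r)) -normrM -gmu mulr1.
  apply: le_trans (ler_norm_sum _ _ _) _.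
  by apply: le_trans (ler_sum _ (fun s _ => g1 s)) _; rewrite sumr_const.
apply: (chernoff (g := fun s => g s - mu)) => //.
- by rewrite sumrB gmu sumr_const -(mulr_natl mu) subrr.
- move=> s; apply: le_trans (ler_normB _ _) _.
  by rewrite (_ : 2 = 1 + 1) // lerD.
rewrite (eq_bigr (fun s => g s ^+ 2 - 2 * mu * g s + mu ^+ 2)); last first.
  by move=> s _; ring.
rewrite big_split sumrB /= -mulr_sumr gmu sumr_const.
have g2 : \sum_s g s ^+ 2 <= #|S|%:R.
  rewrite -sumr_const; apply: ler_sum => s _.
  by rewrite -real_normK ?num_real // exprn_ile1.
rewrite -(mulr_natl (mu ^+ 2)); have := sqr_ge0 mu; nra.
Qed.

Lemma complex_chernoff (R : realType) (S : finType) (h : S -> R[i]) (m : R[i])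
    (M : nat) (b : R) :
  (0 < #|S|)%N -> (0 < M)%N -> (forall s, normc (h s) <= 1) ->
  \sum_s h s = #|S|%:R * m -> 0 <= b -> b ^+ 2 <= 9 / 128 ->
  \sum_(x : {ffun 'I_M -> S} | b < normc (M%:R^-1 * \sum_j h (x j) - m)) 1
    <= #|S|%:R ^+ M * (4 * expR (- (M%:R * b ^+ 2 / 6))) :> R.
Proof.
(* With t = b / sqrt 2, a modulus above b forces the real or the imaginary part to deviate by more
   than t. The bound 9/128 is 2 (3/16)^2. *)
move=> S0 M0 h1 hm b0 bs; pose t := Num.sqrt (b ^+ 2 / 2).
have b20 : 0 <= b ^+ 2 / 2 by rewrite divr_ge0 ?sqr_ge0.
have tt : t ^+ 2 = b ^+ 2 / 2 by rewrite sqr_sqrtr.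
have t0 : 0 <= t := sqrtr_ge0 _.
have ht : 0 <= t <= 3 / 16 by rewrite t0 /=; nra.
have M0r : 0 < M%:R :> R by rewrite ltr0n.
have hRI s : complex.Re (h s) ^+ 2 + complex.Im (h s) ^+ 2 <= 1.
  by rewrite -sqr_normcE exprn_ile1 // normc_ge0.
have Re1 s : `|complex.Re (h s)| <= 1.
  rewrite ler_norml; have := hRI s; have := sqr_ge0 (complex.Im (h s)); nra.
have Im1 s : `|complex.Im (h s)| <= 1.
  rewrite ler_norml; have := hRI s; have := sqr_ge0 (complex.Re (h s)); nra.
have natRe (k : nat) (x : R[i]) : complex.Re (k%:R * x) = k%:R * complex.Re x.
  by rewrite -(rmorph_nat (real_complex R)); case: x => ? ?; simpc.
have natIm (k : nat) (x : R[i]) : complex.Im (k%:R * x) = k%:R * complex.Im x.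
  by rewrite -(rmorph_nat (real_complex R)); case: x => ? ?; simpc.
have hRe : \sum_s complex.Re (h s) = #|S|%:R * complex.Re m.
  by rewrite -Re_sum hm natRe.
have hIm : \sum_s complex.Im (h s) = #|S|%:R * complex.Im m.
  by rewrite -Im_sum hm natIm.
pose E := #|S|%:R ^+ M * expR (- (M%:R * t ^+ 2 / 3)) : R.
(* A square above (M t)^2 is an upper tail of g or of -g; two such tails for each of the real and
   imaginary parts make the factor 4. *)
have signed (g : S -> R) (mu : R) : (forall s, `|g s| <= 1) ->
    \sum_s g s = #|S|%:R * mu ->
    \sum_(x : {ffun 'I_M -> S} |
        (M%:R * t) ^+ 2 < (\sum_j (g (x j) - mu)) ^+ 2) 1
       <= 2 * E.
  move=> g1 gmu; have c1 := chernoff_mean M S0 g1 gmu ht.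
  have g1N s : `|- g s| <= 1 by rewrite normrN.
  have gmuN : \sum_s - g s = #|S|%:R * - mu by rewrite sumrN gmu mulrN.
  have c2 := chernoff_mean M S0 g1N gmuN ht.
  rewrite (_ : 2 * E = E + E); last by ring.
  apply: le_trans (lerD c1 c2).
  rewrite [X in X <= _]big_mkcond [X in _ <= X + _]big_mkcond.
  rewrite [X in _ <= _ + X]big_mkcond.
  rewrite -big_split /=; apply: ler_sum => x _.
  have -> : \sum_j (- g (x j) - - mu) = - \sum_j (g (x j) - mu).
    by rewrite -sumrN; apply: eq_bigr => j _; rewrite opprB opprK addrC.
  have Mt0 : 0 <= M%:R * t by rewrite mulr_ge0.
  case: ifPn => [sq|_]; last by case: ifP; case: ifP; lra.
  case: ifPn => [_|]; first by case: ifP; lra.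
  rewrite -leNgt => h'; case: ifPn => [_|]; first lra.
  rewrite -leNgt; nra.
have cRe := signed _ _ Re1 hRe; have cIm := signed _ _ Im1 hIm.
have -> : #|S|%:R ^+ M * (4 * expR (- (M%:R * b ^+ 2 / 6))) = 2 * E + 2 * E.
  rewrite /E tt (_ : M%:R * (b ^+ 2 / 2) / 3 = M%:R * b ^+ 2 / 6).
    by ring.
  by field.
apply: le_trans (lerD cRe cIm).
rewrite [X in X <= _]big_mkcond [X in _ <= X + _]big_mkcond.
rewrite [X in _ <= _ + X]big_mkcond.
rewrite -big_split /=; apply: ler_sum => x _.
case: ifPn => [bad|_]; last by case: ifP; case: ifP; lra.
set sr := \sum_j _; set si := \sum_j (complex.Im _ - _).
suff : (M%:R * t) ^+ 2 + (M%:R * t) ^+ 2 < sr ^+ 2 + si ^+ 2.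
  case: ifPn => [_|]; first by case: ifP; lra.
  rewrite -leNgt => h'; case: ifPn => [_|]; first lra.
  rewrite -leNgt; lra.
pose z := \sum_j (h (x j) - m).
have -> : sr ^+ 2 + si ^+ 2 = normc z ^+ 2.
  have ReB (u v : R[i]) : complex.Re (u - v) = complex.Re u - complex.Re v.
    by case: u v => [? ?] [].
  have ImB (u v : R[i]) : complex.Im (u - v) = complex.Im u - complex.Im v.
    by case: u v => [? ?] [].
  rewrite sqr_normcE Re_sum Im_sum; congr (_ ^+ 2 + _ ^+ 2);
    by apply: eq_bigr => j _; rewrite ?ReB ?ImB.
have zE : normc z = M%:R * normc (M%:R^-1 * \sum_j h (x j) - m).
  have {1}-> : M%:R = normc (M%:R : R[i]) :> R.
    rewrite -(rmorph_nat (real_complex R)) /= expr0n addr0 sqrtr_sqr.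
    by rewrite ger0_norm // ltW.
  rewrite -normcM mulrBr mulrA divff ?mul1r; last by rewrite pnatr_eq0 -lt0n.
  by rewrite /z sumrB sumr_const card_ord mulr_natl.
rewrite zE !exprMn tt -mulrDr ltr_pM2l ?exprn_gt0 // -splitr.
by rewrite ltrXn2r // nnegrE ?normc_ge0.
Qed.

(** * Numerical estimates for the union bound *)

Lemma ln_ge4_3 (R : realType) (x : R) : 6 <= x -> 4 / 3 <= ln x.
Proof.
move=> x6; have x0 : 0 < x by lra.
rewrite -(expRK (4 / 3)) ler_ln ?posrE ?expR_gt0 //; apply: le_trans x6.
have h : (5 / 6) ^+ 8 <= expR (- (4 / 3)) :> R.
  have -> : - (4 / 3) = - 6^-1 * 8%:R :> R by lra.
  have h1 : 5 / 6 <= expR (- 6^-1) :> R.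
    by apply: le_trans (expR_ge1Dx _); lra.
  rewrite expRM_natr lerXn2r ?nnegrE ?expR_ge0 //; lra.
have := expRxMexpNx_1 (4 / 3 : R); have := expR_gt0 (4 / 3 : R); nra.
Qed.

(** With L >= 4/3 the surplus d L / 4 is at least 1/3, so exp(-T) <= y^(-d) exp(-1/3), where
    exp(-1/3) <= 3/4. Moreover (n+1) / y <= delta / 3, because n+1 <= 2n and K >= 3; the product is
    at most 4 * 3/4 * delta / 3 = delta. *)
Lemma union_bound_small (R : realType) (K n d : nat) (delta T : R) :
  (3 <= K)%N -> (1 <= n)%N -> (1 <= d)%N -> 0 < delta < 1 ->
  5 / 4 * d%:R * ln (2 * K%:R * n%:R / delta) <= T ->
  (n.+1 ^ d)%:R * (4 * expR (- T)) <= delta.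
Proof.
move=> K3 n1 d1 /andP[de0 de1]; pose y := 2 * K%:R * n%:R / delta; rewrite -/y.
set L := ln y => hT.
have Kr : 3 <= K%:R :> R by rewrite ler_nat.
have nr : 1 <= n%:R :> R by rewrite ler1n.
have dr : 1 <= d%:R :> R by rewrite ler1n.
have Kn : 3 <= K%:R * n%:R :> R by nra.
have y6 : 6 <= y by rewrite ler_pdivlMr //; lra.
have y0 : 0 < y by lra.
have L43 : 4 / 3 <= L := ln_ge4_3 y6.
have e1 : expR (- T) <= (y^-1) ^+ d * expR (- 3^-1).
  rewrite -[y^-1]lnK ?posrE ?invr_gt0 // -expRM_natr -expRD.
  rewrite ler_expR lnV ?posrE //.
  rewrite -/L; nra.
have e2 : expR (- 3^-1) <= 3 / 4 :> R.
  have := expRxMexpNx_1 (3^-1 : R); have := expR_ge1Dx (3^-1 : R).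
  have := expR_gt0 (- 3^-1 : R); nra.
have e3 : (n.+1 ^ d)%:R * (y^-1) ^+ d <= delta / 3.
  rewrite natrX -exprMn; apply: (@le_trans _ _ ((delta / 3) ^+ d)).
    rewrite lerXn2r ?nnegrE ?mulr_ge0 ?invr_ge0 ?(ltW y0) ?(ltW de0) //.
    rewrite /y invf_div mulrA ler_pdivrMr; last by rewrite !mulr_gt0; lra.
    have nK : n.+1%:R <= 2 / 3 * (K%:R * n%:R) :> R by rewrite -(natr1 n); nra.
    have := ler_wpM2l (ltW de0) nK; lra.
  apply: ler_iXnr; rewrite ?d1 //; lra.
have p0 : 0 <= (n.+1 ^ d)%:R :> R by [].
have q0 : 0 <= (y^-1) ^+ d by rewrite exprn_ge0 // invr_ge0 ltW.
have s0 := expR_gt0 (- 3^-1 : R).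
apply: (@le_trans _ _ ((n.+1 ^ d)%:R * (4 * ((y^-1) ^+ d * (3 / 4))))).
  rewrite ler_wpM2l // ler_wpM2l //; apply: le_trans e1 _.
  by rewrite ler_wpM2l.
by lra.
Qed.

(** * The learner and its guarantee *)

Definition empirical_coef (R : realType) (K n M : nat)
    (data : 'I_M -> cube R K n * R[i]) (al : mindex K n) : R[i] :=
  M%:R^-1 * \sum_j (data j).2 * (monomial al (data j).1)^*.

Definition threshold_learner (R : realType) (K n d M : nat) (b : R)
    (data : 'I_M -> cube R K n * R[i]) (al : mindex K n) : R[i] :=
  if (mdeg al <= d)%N &&
     (b * (1 + Num.sqrt d.+1%:R) <= normc (empirical_coef data al))
  then empirical_coef data al else 0.

Lemma zpolyB (R : realType) (K n : nat) (a c : mindex K n -> R[i])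
    (z : cube R K n) :
  zpoly a z - zpoly c z = zpoly (fun al => a al - c al) z.
Proof. by rewrite /zpoly -sumrB; apply: eq_bigr => al _; rewrite mulrBl. Qed.

Theorem proposition6 (R : realType) (K n d : nat)
  (hK : (3 <= K)%N) (hn : (1 <= n)%N) (hd : (1 <= d)%N)
  (eps delta : R) (heps : 0 < eps < 1) (hdelta : 0 < delta < 1)
  (M : nat)
  (hM : ((expR 5 * d%:R * (d%:R + 1))%:E * BH R K d ^+ (2 * d)
           / (eps ^+ d.+1)%:E * (ln (2 * K%:R * n%:R / delta))%:E
         <= M%:R%:E)%E) :
  exists learn : ('I_M -> cube R K n * R[i]) -> (mindex K n -> R[i]),
  forall f : cube R K n -> R[i],
    degree_le d f -> supnorm f <= 1 ->
  forall (disp : measure_display) (T : measurableType disp)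
         (P : probability T R) (X : 'I_M -> T -> cube R K n),
    iid_uniform P X ->
    ((1 - delta)%:E <=
     P [set w : T |
        let ftilde := zpoly (learn (fun j => (X j w, f (X j w)))) in
        (l2norm (fun z => f z - ftilde z) ^+ 2 <= eps)%R])%E.
Proof.
have K0 : (0 < K)%N by exact: leq_trans hK.
have /andP[e0 e1] := heps; have /andP[de0 de1] := hdelta.
have Kr : 3 <= K%:R :> R by rewrite ler_nat.
have nr : 1 <= n%:R :> R by rewrite ler1n.
have dr : 1 <= d%:R :> R by rewrite ler1n.
set L := ln _ in hM.
have L0 : 0 < L.
  apply: (@lt_le_trans _ _ (4 / 3)) => //; apply: ln_ge4_3.
  by rewrite ler_pdivlMr //; nra.
have C0 : 0 < expR 5 * d%:R * (d%:R + 1) :> R.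
  by rewrite !mulr_gt0 ?expR_gt0 //; lra.
have eD0 : 0 < eps ^+ d.+1 by rewrite exprn_gt0.
(* [BH_ge1] excludes -oo. If [BH] were +oo, the left side of [hM] would be +oo as well, its other
   factors being positive (L > 0 matters, as +oo * 0 = 0). *)
have [B BE] : exists B, BH R K d = B%:E.
  move: (BH_ge1 R K0 hd) hM; case: (BH R K d) => [B _ _| _|//].
    by exists B.
  have powy m : (+oo ^+ m.+1 = +oo :> \bar R)%E.
    by elim: m => // m IHm; rewrite expeS IHm mulyy.
  rewrite -(@prednK (2 * d)) ?muln_gt0 // powy.
  rewrite inver gt_eqF // gt0_muley // ?lte_fin //.
  by rewrite !gt0_mulye ?lte_fin ?invr_gt0 // leye_eq.
have B1 : 1 <= B by rewrite -lee_fin -BE BH_ge1.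
have B0 : 0 < B by lra.
have BP : 1 <= B ^+ (2 * d) by rewrite exprn_ege1.
set BD := B ^+ (2 * d) in BP *.
have hMr : expR 5 * d%:R * (d%:R + 1) * BD / eps ^+ d.+1 * L <= M%:R.
  by move: hM; rewrite BE inver gt_eqF // -EFin_expe -!EFinM lee_fin.
have M0r : 0 < M%:R :> R.
  apply: lt_le_trans hMr; rewrite mulr_gt0 // mulr_gt0 ?invr_gt0 //.
  by rewrite mulr_gt0 //; lra.
have M0 : (0 < M)%N by rewrite -(ltr0n R).
pose b2 := eps ^+ d.+1 / (6 * expR 1 * d.+1%:R * BD).
have x0 : 0 < 6 * expR 1 * d.+1%:R * BD.
  by rewrite !mulr_gt0 ?expR_gt0 //; lra.
have b20 : 0 < b2 by rewrite divr_gt0.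
pose b := Num.sqrt b2.
have b0 : 0 < b by rewrite sqrtr_gt0.
have bb : b ^+ 2 = b2 by rewrite sqr_sqrtr // ltW.
(* The denominator of [b2] is at least 24, which puts b within the range of [complex_chernoff]. *)
have bs : b ^+ 2 <= 9 / 128.
  rewrite bb ler_pdivrMr //.
  have h1 : eps ^+ d.+1 <= 1 by rewrite exprn_ile1 // ltW.
  have h2 : 2 <= expR 1 :> R by apply: le_trans (expR_ge1Dx _); lra.
  have h3 : 2 <= d.+1%:R :> R by rewrite ler_nat.
  have h4 : 4 <= expR 1 * d.+1%:R :> R by nra.
  have h5 : 4 <= expR 1 * d.+1%:R * BD :> R by nra.
  lra.
(* Multiplying [hMr] by b^2 cancels BH and eps and leaves e^4 d L / 6; the further division by 6
   gives e^4 / 36 >= 45/36 = 5/4. *)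
have hT : 5 / 4 * d%:R * L <= M%:R * b ^+ 2 / 6.
  have h1 : expR 4 / 6 * d%:R * L <= M%:R * b ^+ 2.
    have -> : expR 4 / 6 * d%:R * L =
        expR 5 * d%:R * (d%:R + 1) * BD / eps ^+ d.+1 * L * b ^+ 2.
      have e5 : expR 5 = expR 4 * expR 1 :> R.
        by rewrite -expRD; congr expR; lra.
      have B1' : BD != 0 by rewrite gt_eqF //; lra.
      have dn : d%:R + 1 != 0 :> R by rewrite gt_eqF //; lra.
      have e1n : expR 1 != 0 :> R by rewrite gt_eqF ?expR_gt0.
      have eDn : eps ^+ d.+1 != 0 by rewrite gt_eqF.
      rewrite bb /b2 e5 -(natr1 d); field.
      by rewrite eDn B1' e1n dn.
    by rewrite ler_wpM2r // sqr_ge0.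
  have dL : 0 <= d%:R * L by rewrite mulr_ge0 // ltW.
  have := expR4_ge45 R; nra.
(* The threshold [b] depends only on K, d and eps, so the rule is fixed before f. *)
exists (threshold_learner d b) => f [a fa adeg] fnorm disp T P X iX.
set Q := fun x : {ffun 'I_M -> cube R K n} =>
  l2norm (fun z =>
    f z - zpoly (threshold_learner d b (fun j => (x j, f (x j)))) z) ^+ 2 <= eps.
have -> : [set w | let ftilde := zpoly (threshold_learner d b
              (fun j => (X j w, f (X j w)))) in
            l2norm (fun z => f z - ftilde z) ^+ 2 <= eps] =
          [set w | Q [ffun j => X j w]].
  apply/funext => w /=; rewrite /Q.
  rewrite (_ : (fun j => ([ffun j => X j w] j, f ([ffun j => X j w] j))) =
    (fun j => (X j w, f (X j w)))) //.
  by apply/funext => j; rewrite ffunE.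
rewrite (prob_iid_uniform Q iX) lee_fin.
set N := #|cube R K n|%:R ^+ M.
have c0 : (0 < #|cube R K n|)%N by rewrite card_cube // expn_gt0 K0.
have N0 : 0 < N by rewrite exprn_gt0 // ltr0n.
(* It remains to see that at most delta N of the N tuples fail [Q]. *)
rewrite ler_pdivlMr // mulrBl mul1r lerBlDr.
pose bad al (x : {ffun 'I_M -> cube R K n}) :=
  b < normc (M%:R^-1 * \sum_j f (x j) * (monomial al (x j))^* - a al).
(* The deterministic half: if every estimate is within b, Parseval and [thresholding_error] give
   [Q]. *)
have QNbad x : ~~ Q x -> exists2 al, (mdeg al <= d)%N & bad al x.
  move=> nQ; apply: contrapT => nbad; move/negP: nQ; apply; rewrite /Q.
  rewrite [X in l2norm X](_ : _ = zpoly (fun al => a al -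
     threshold_learner d b (fun j => (x j, f (x j))) al)); last first.
    by apply/funext => z; rewrite {1}fa zpolyB.
  rewrite parseval //.
  apply: (thresholding_error (A := fun al => (mdeg al <= d)%N) hd e0 B1 b0 bb).
  - by move=> al; rewrite -ltnNge => /adeg.
  - by move=> al hal; rewrite leNgt; apply/negP => h; apply: nbad; exists al.
  - by apply: sum_coef_le_BH => //; rewrite -fa.
have badP al : \sum_(x | bad al x) 1 <= N * (4 * expR (- (M%:R * b ^+ 2 / 6))).
  (* This function has modulus at most 1 and, by orthogonality, mean a_al. *)
  apply: (complex_chernoff (h := fun z => f z * (monomial al z)^*)) => //.
  - move=> z; rewrite normcM.
    have -> : normc (monomial al z)^* = 1.
      rewrite -(normc_monomial al z); case: (monomial al z) => u v /=.
      by rewrite sqrrN.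
    by rewrite mulr1; apply: le_trans fnorm; exact: normc_le_supnorm.
  - by rewrite fa sum_zpoly_conj_monomial.
  - exact: ltW.
have total : N = \sum_(x | Q x) 1 + \sum_(x | ~~ Q x) 1.
  rewrite -(bigID Q xpredT (fun _ : {ffun 'I_M -> cube R K n} => 1)) /=.
  by rewrite sumr_const card_ffun card_ord natrX.
rewrite {1}total lerD2l.
(* Union bound: after exchanging the sums, each failing tuple is counted at least once. *)
apply: (@le_trans _ _ (\sum_(al | (mdeg al <= d)%N) \sum_(x | bad al x) 1)).
  under [leRHS]eq_bigr do rewrite big_mkcond.
  rewrite exchange_big /= [leLHS]big_mkcond; apply: ler_sum => x _.
  case: ifPn => [/QNbad[al hal hb]|_]; last first.
    by rewrite sumr_ge0 // => al _; case: ifP.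
  rewrite (bigD1 al) //= hb lerDl sumr_ge0 // => be _; by case: ifP.
apply: le_trans (ler_sum _ (fun al _ => badP al)) _.
rewrite sumr_const -[X in X <= _]mulr_natl mulrCA mulrC ler_wpM2r ?(ltW N0) //.
apply: le_trans (union_bound_small hK hn hd hdelta hT).
rewrite ler_wpM2r ?mulr_ge0 ?expR_ge0 // ler_nat.
by apply: leq_trans (card_mdeg_le n d K0); rewrite cardsE.
Qed.
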